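(* The axiom $\mathsf{STP}$ is provable in $\mathsf P+\mathsf{NUC}$, where $\mathsf{NUC}$ is \[ (\forall^{\mathrm{st}}Y^2)(\forall f^1,g^1\le_11)(f\approx_1g\to Y(f)=_0Y(g)). \]
   Context: Framework. $\mathsf{E\text{-}PA}^{\omega*}$ is Peano arithmetic in all finite types with the axiom of extensionality, with additional types $\rho^*$ of finite sequences; type $0$ = naturals, $1=0\to0$, $2=1\to0$. The language of $\mathsf P$ adds a predicate $\mathrm{st}$ (''standard'') for every type; $(\forall^{\mathrm{st}}x)\varphi\equiv(\forall x)(\mathrm{st}(x)\to\varphi)$, $(\exists^{\mathrm{st}}x)\varphi\equiv(\exists x)(\mathrm{st}(x)\wedge\varphi)$; internal = not containing $\mathrm{st}$. $\mathsf P$ is $\mathsf{E\text{-}PA}^{\omega*}$ plus: (i) $\mathrm{st}(x)\wedge x=y\to\mathrm{st}(y)$; (ii) $\mathrm{st}(t)$ for each closed term $t$ of $\mathsf{E\text{-}PA}^{\omega*}$; (iii) $\mathrm{st}(f)\wedge\mathrm{st}(x)\to\mathrm{st}(f(x))$; (iv) external induction for every formula; (v) $\mathsf{HAC}_{\mathrm{int}}$: for internal $\varphi$, $(\forall^{\mathrm{st}}x^\rho)(\exists^{\mathrm{st}}y^\tau)\varphi(x,y)\to(\exists^{\mathrm{st}}F^{\rho\to\tau^*})(\forall^{\mathrm{st}}x^\rho)(\exists y\in F(x))\varphi(x,y)$; (vi) idealisation: for internal $\varphi$ with arbitrary parameters, $(\forall^{\mathrm{st}}x^{\sigma^*})(\exists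 y^\tau)(\forall z^\sigma\in x)\varphi(z,y)\to(\exists y^\tau)(\forall^{\mathrm{st}}x^\sigma)\varphi(x,y)$. $f\approx_1g$ means $(\forall^{\mathrm{st}}n^0)f(n)=g(n)$; $f\le_11$ means $(\forall n)f(n)\le1$. $\mathsf{STP}$: $(\forall f^1\le_11)(\exists^{\mathrm{st}}g^1\le_11)(f\approx_1g)$. *)

(* Defs.v *)
From Stdlib Require Import List.
Import ListNotations.

Set Implicit Arguments.

Inductive ty : Type :=
| N : ty
| Arr : ty -> ty -> ty
| Seq : ty -> ty.

Declare Scope ty_scope.
Delimit Scope ty_scope with ty.
Bind Scope ty_scope with ty.
Infix "~>" := Arr (at level 55, right associativity) : ty_scope.
Local Open Scope ty_scope.

Definition ty1 : ty := N ~> N.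
Definition ty2 : ty := ty1 ~> N.

Definition ctx : Type := list ty.

Inductive var : ctx -> ty -> Type :=
| VZ : forall (G : ctx) (s : ty), var (s :: G) s
| VS : forall (G : ctx) (s r : ty), var G s -> var (r :: G) s.
Arguments VZ {G s}.
Arguments VS {G s r} _.

Inductive con : ty -> Type :=
| cK : forall s t : ty, con (s ~> t ~> s)
| cS : forall r s t : ty, con ((r ~> s ~> t) ~> (r ~> s) ~> r ~> t)
| cZero : con N
| cSucc : con (N ~> N)
| cRec : forall r : ty, con (r ~> (r ~> N ~> r) ~> N ~> r)
| cNil : forall s : ty, con (Seq s)
| cCons : forall s : ty, con (s ~> Seq s ~> Seq s)
| cLRec : forall s r : ty, con (r ~> (r ~> s ~> r) ~> Seq s ~> r).

Inductive tm (G : ctx) : ty -> Type :=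
| Var : forall s : ty, var G s -> tm G s
| Con : forall s : ty, con s -> tm G s
| App : forall s t : ty, tm G (s ~> t) -> tm G s -> tm G t.
Arguments Var {G s} _.
Arguments Con {G s} _.
Arguments App {G s t} _ _.

Declare Scope tm_scope.
Delimit Scope tm_scope with tm.
Bind Scope tm_scope with tm.
Notation "f $ x" := (App f x) (at level 40, left associativity) : tm_scope.
Local Open Scope tm_scope.

Definition v0 {G : ctx} {a : ty} : tm (a :: G) a := Var VZ.
Definition v1 {G : ctx} {a b : ty} : tm (b :: a :: G) a := Var (VS VZ).
Definition v2 {G : ctx} {a b c : ty} : tm (c :: b :: a :: G) a :=
  Var (VS (VS VZ)).

Inductive form : ctx -> Type :=
| Bot : forall G : ctx, form G
| Eq : forall (G : ctx) (s : ty), tm G s -> tm G s -> form G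
| St : forall (G : ctx) (s : ty), tm G s -> form G
| And : forall G : ctx, form G -> form G -> form G
| Or : forall G : ctx, form G -> form G -> form G
| Imp : forall G : ctx, form G -> form G -> form G
| All : forall (G : ctx) (s : ty), form (s :: G) -> form G
| Ex : forall (G : ctx) (s : ty), form (s :: G) -> form G.
Arguments Bot {G}.
Arguments Eq {G s} _ _.
Arguments St {G s} _.
Arguments And {G} _ _.
Arguments Or {G} _ _.
Arguments Imp {G} _ _.
Arguments All {G} s _.
Arguments Ex {G} s _.

Definition Not {G : ctx} (p : form G) : form G := Imp p Bot.

Fixpoint internal {G : ctx} (p : form G) : Prop :=
  match p with
  | Bot => True
  | Eq _ _ => True
  | St _ => False
  | And p q => internal p /\ internal q
  | Or p q => internal p /\ internal q
  | Imp p q => internal p /\ internal q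
  | All _ p => internal p
  | Ex _ p => internal p
  end.

Definition renaming (G D : ctx) : Type := forall s : ty, var G s -> var D s.
Definition substitution (G D : ctx) : Type := forall s : ty, var G s -> tm D s.

Definition vcase {r : ty} {G : ctx} (P : ty -> Type) (z : P r)
    (f : forall s : ty, var G s -> P s) (s : ty) (x : var (r :: G) s) : P s :=
  match x in var D s
    return match D with
           | [] => unit
           | r :: G => P r -> (forall s : ty, var G s -> P s) -> P s
           end with
  | VZ => fun z _ => z
  | VS y => fun _ f => f _ y
  end z f.

Definition up_ren {G D : ctx} {r : ty} (f : renaming G D) :
    renaming (r :: G) (r :: D) :=
  vcase (var (r :: D)) VZ (fun s x => VS (f s x)).

Fixpoint ren_tm {G D : ctx} (f : renaming G D) {s : ty} (t : tm G s) : tm D s :=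
  match t with
  | Var x => Var (f _ x)
  | Con c => Con c
  | App a b => App (ren_tm f a) (ren_tm f b)
  end.

Fixpoint ren {G D : ctx} (f : renaming G D) (p : form G) : form D :=
  match p in form G return renaming G D -> form D with
  | Bot => fun _ => Bot
  | Eq a b => fun f => Eq (ren_tm f a) (ren_tm f b)
  | St a => fun f => St (ren_tm f a)
  | And p q => fun f => And (ren f p) (ren f q)
  | Or p q => fun f => Or (ren f p) (ren f q)
  | Imp p q => fun f => Imp (ren f p) (ren f q)
  | All s p => fun f => All s (ren (up_ren f) p)
  | Ex s p => fun f => Ex s (ren (up_ren f) p)
  end f.

Definition shift {G : ctx} {r : ty} : renaming G (r :: G) := fun _ x => VS x.
Definition wk_tm {G : ctx} {r s : ty} (t : tm G s) : tm (r :: G) s :=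
  ren_tm shift t.
Definition wk {G : ctx} {r : ty} (p : form G) : form (r :: G) :=
  ren shift p.

(* Inserts an unused variable below the two innermost ones. *)
Definition wk_under2 {G : ctx} {a b r : ty} (p : form (a :: b :: G)) :
    form (a :: b :: r :: G) :=
  ren (up_ren (up_ren shift)) p.

Definition of_nil {G : ctx} : renaming [] G :=
  fun s x => match x in var D _ return match D with
                                       | [] => var G s
                                       | _ :: _ => unit
                                       end with
             | VZ => tt
             | VS _ => tt
             end.

Definition scons {G D : ctx} {r : ty} (t : tm D r) (f : substitution G D) :
    substitution (r :: G) D :=
  vcase (tm D) t f.

Definition up_sub {G D : ctx} {r : ty} (f : substitution G D) :
    substitution (r :: G) (r :: D) :=
  scons v0 (fun s x => wk_tm (f s x)).

Fixpoint sub_tm {G D : ctx} (f : substitution G D) {s : ty} (t : tm G s) :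
    tm D s :=
  match t with
  | Var x => f _ x
  | Con c => Con c
  | App a b => App (sub_tm f a) (sub_tm f b)
  end.

Fixpoint sub {G D : ctx} (f : substitution G D) (p : form G) : form D :=
  match p in form G return substitution G D -> form D with
  | Bot => fun _ => Bot
  | Eq a b => fun f => Eq (sub_tm f a) (sub_tm f b)
  | St a => fun f => St (sub_tm f a)
  | And p q => fun f => And (sub f p) (sub f q)
  | Or p q => fun f => Or (sub f p) (sub f q)
  | Imp p q => fun f => Imp (sub f p) (sub f q)
  | All s p => fun f => All s (sub (up_sub f) p)
  | Ex s p => fun f => Ex s (sub (up_sub f) p)
  end f.

(* [inst t p] is p(t), where the innermost variable is replaced by t. *)
Definition inst {G : ctx} {r : ty} (t : tm G r) (p : form (r :: G)) : form G :=
  sub (scons t (fun s x => Var x)) p.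

(* Bracket abstraction; the object language has only combinators. *)
Fixpoint abs_with {G D : ctx} {r : ty}
    (e : forall s : ty, var G s -> tm D (r ~> s)) {s : ty} (t : tm G s) :
    tm D (r ~> s) :=
  match t with
  | Var x => e _ x
  | Con c => Con (cK _ r) $ Con c
  | App a b => Con (cS r _ _) $ abs_with e a $ abs_with e b
  end.

Definition lam {G : ctx} {r s : ty} (t : tm (r :: G) s) : tm G (r ~> s) :=
  abs_with
    (vcase (fun s => tm G (r ~> s))
       (Con (cS r (r ~> r) r) $ Con (cK r (r ~> r)) $ Con (cK r r))
       (fun s x => Con (cK s r) $ Var x))
    t.

Definition zero {G : ctx} : tm G N := Con cZero.
Definition succ {G : ctx} (t : tm G N) : tm G N := Con cSucc $ t.
Definition one {G : ctx} : tm G N := succ zero.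

Definition add {G : ctx} (a b : tm G N) : tm G N :=
  Con (cRec N) $ a $ lam (lam (succ v1)) $ b.

Definition tnil {G : ctx} {s : ty} : tm G (Seq s) := Con (cNil s).
Definition tcons {G : ctx} {s : ty} (a : tm G s) (l : tm G (Seq s)) :
    tm G (Seq s) :=
  Con (cCons s) $ a $ l.

Fixpoint default {G : ctx} (s : ty) : tm G s :=
  match s with
  | N => zero
  | Arr r t => Con (cK t r) $ default t
  | Seq r => tnil
  end.

Definition tlen {G : ctx} {s : ty} (l : tm G (Seq s)) : tm G N :=
  Con (cLRec s N) $ zero $ lam (lam (succ v1)) $ l.

(* [tnth l i] is the entry l_i of l (counting from 0), and [default s] when i
   is at least the length of l.  The step maps the lookup function h of the
   tail and the head a to the function sending 0 to a and i+1 to h(i). *)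
Definition tnth {G : ctx} {s : ty} (l : tm G (Seq s)) (i : tm G N) : tm G s :=
  Con (cLRec s (N ~> s))
    $ lam (default s)
    $ lam (lam (lam (Con (cRec s) $ v1 $ lam (lam (Var (VS (VS (VS (VS VZ)))) $ v0)) $ v0)))
    $ l $ i.

Definition Le {G : ctx} (a b : tm G N) : form G :=
  Ex N (Eq (add (wk_tm a) v0) (wk_tm b)).
Definition Lt {G : ctx} (a b : tm G N) : form G := Le (succ a) b.

Definition Mem {G : ctx} {s : ty} (a : tm G s) (l : tm G (Seq s)) : form G :=
  Ex N (And (Lt v0 (tlen (wk_tm l))) (Eq (tnth (wk_tm l) v0) (wk_tm a))).

Definition AllIn {G : ctx} {s : ty} (l : tm G (Seq s)) (p : form (s :: G)) :
    form G :=
  All s (Imp (Mem v0 (wk_tm l)) p).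
Definition ExIn {G : ctx} {s : ty} (l : tm G (Seq s)) (p : form (s :: G)) :
    form G :=
  Ex s (And (Mem v0 (wk_tm l)) p).

Definition AllSt {G : ctx} (s : ty) (p : form (s :: G)) : form G :=
  All s (Imp (St v0) p).
Definition ExSt {G : ctx} (s : ty) (p : form (s :: G)) : form G :=
  Ex s (And (St v0) p).

Arguments AllSt {G} s p.
Arguments ExSt {G} s p.

Definition Le1 {G : ctx} (f : tm G ty1) : form G :=
  All N (Le (wk_tm f $ v0) one).

Definition Approx {G : ctx} (f g : tm G ty1) : form G :=
  AllSt N (Eq (wk_tm f $ v0) (wk_tm g $ v0)).

(* Axioms may have free variables, which act as parameters. *)
Definition theory : Type := forall G : ctx, form G -> Prop.

Inductive deriv (T : theory) : forall G : ctx, list (form G) -> form G -> Prop :=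
| d_ax : forall G H (p : form G), T G p -> deriv T H p
| d_hyp : forall G H (p : form G), In p H -> deriv T H p
| d_botE : forall G H (p : form G), deriv T H Bot -> deriv T H p
| d_raa : forall G H (p : form G), deriv T (Not p :: H) Bot -> deriv T H p
| d_andI : forall G H (p q : form G),
    deriv T H p -> deriv T H q -> deriv T H (And p q)
| d_andE1 : forall G H (p q : form G), deriv T H (And p q) -> deriv T H p
| d_andE2 : forall G H (p q : form G), deriv T H (And p q) -> deriv T H q
| d_orI1 : forall G H (p q : form G), deriv T H p -> deriv T H (Or p q)
| d_orI2 : forall G H (p q : form G), deriv T H q -> deriv T H (Or p q)
| d_orE : forall G H (p q r : form G),
    deriv T H (Or p q) -> deriv T (p :: H) r -> deriv T (q :: H) r ->
    deriv T H r
| d_impI : forall G H (p q : form G), deriv T (p :: H) q -> deriv T H (Imp p q)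
| d_impE : forall G H (p q : form G),
    deriv T H (Imp p q) -> deriv T H p -> deriv T H q
| d_allI : forall G H s (p : form (s :: G)),
    deriv T (map wk H) p -> deriv T H (All s p)
| d_allE : forall G H s (p : form (s :: G)) (t : tm G s),
    deriv T H (All s p) -> deriv T H (inst t p)
| d_exI : forall G H s (p : form (s :: G)) (t : tm G s),
    deriv T H (inst t p) -> deriv T H (Ex s p)
| d_exE : forall G H s (p : form (s :: G)) (q : form G),
    deriv T H (Ex s p) -> deriv T (p :: map wk H) (wk q) -> deriv T H q.

Definition provable (T : theory) (p : form []) : Prop := deriv T [] p.

Definition extend (T : theory) (A : form []) : theory :=
  fun G p => T G p \/ p = ren of_nil A.

(* Peano arithmetic in all finite types and sequence types, with equality
   primitive at every type and replacement restricted to internal formulas. *)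
Inductive EPA : theory :=
| eq_refl_ax : forall G s (a : tm G s), EPA (Eq a a)
| eq_subst_ax : forall G s (a b : tm G s) (p : form (s :: G)), internal p ->
    EPA (Imp (Eq a b) (Imp (inst a p) (inst b p)))
| ext_ax : forall G s t (f g : tm G (s ~> t)),
    EPA (Imp (All s (Eq (wk_tm f $ v0) (wk_tm g $ v0))) (Eq f g))
| K_ax : forall G s t (a : tm G s) (b : tm G t),
    EPA (Eq (Con (cK s t) $ a $ b) a)
| S_ax : forall G r s t
    (a : tm G (r ~> s ~> t)) (b : tm G (r ~> s)) (c : tm G r),
    EPA (Eq (Con (cS r s t) $ a $ b $ c) (a $ c $ (b $ c)))
| succ_ne_zero_ax : forall G (a : tm G N), EPA (Not (Eq (succ a) zero))
| succ_inj_ax : forall G (a b : tm G N),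
    EPA (Imp (Eq (succ a) (succ b)) (Eq a b))
| ind_ax : forall G (p : form (N :: G)), internal p ->
    EPA (Imp (And (inst zero p)
                  (All N (Imp p (sub (scons (succ v0) (fun s x => Var (VS x))) p))))
             (All N p))
| rec_zero_ax : forall G r (a : tm G r) (b : tm G (r ~> N ~> r)),
    EPA (Eq (Con (cRec r) $ a $ b $ zero) a)
| rec_succ_ax : forall G r (a : tm G r) (b : tm G (r ~> N ~> r)) (n : tm G N),
    EPA (Eq (Con (cRec r) $ a $ b $ succ n)
            (b $ (Con (cRec r) $ a $ b $ n) $ n))
| lrec_nil_ax : forall G s r (a : tm G r) (b : tm G (r ~> s ~> r)),
    EPA (Eq (Con (cLRec s r) $ a $ b $ tnil) a)
| lrec_cons_ax : forall G s r (a : tm G r) (b : tm G (r ~> s ~> r))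
    (x : tm G s) (l : tm G (Seq s)),
    EPA (Eq (Con (cLRec s r) $ a $ b $ tcons x l)
            (b $ (Con (cLRec s r) $ a $ b $ l) $ x))
| seq_ax : forall G s (l : tm G (Seq s)),
    EPA (Or (Eq l tnil)
            (Ex s (Ex (Seq s) (Eq (wk_tm (wk_tm l)) (tcons v1 v0))))).

Inductive P : theory :=
| EPA_ax : forall G (p : form G), EPA p -> P p
| st_eq_ax : forall G s (a b : tm G s), P (Imp (And (St a) (Eq a b)) (St b))
| st_closed_ax : forall G s (t : tm [] s), P (St (ren_tm (@of_nil G) t))
| st_app_ax : forall G s t (f : tm G (s ~> t)) (a : tm G s),
    P (Imp (And (St f) (St a)) (St (f $ a)))
| st_ind_ax : forall G (p : form (N :: G)),
    P (Imp (And (inst zero p)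
                (AllSt N (Imp p (sub (scons (succ v0) (fun s x => Var (VS x))) p))))
           (AllSt N p))
(* In p = phi(x, y), x is the second innermost variable and y the innermost. *)
| HAC_int_ax : forall G r t (p : form (t :: r :: G)), internal p ->
    P (Imp (AllSt r (ExSt t p))
           (ExSt (r ~> Seq t) (AllSt r (ExIn (v1 $ v0) (wk_under2 p)))))
(* In p = phi(z, y), z is the innermost variable and y the second innermost. *)
| ideal_ax : forall G s t (p : form (s :: t :: G)), internal p ->
    P (Imp (AllSt (Seq s) (Ex t (AllIn v1 (wk_under2 p))))
           (Ex t (AllSt s p))).

Definition NUC : form [] :=
  AllSt ty2 (All ty1 (All ty1
    (Imp (And (Le1 v1) (Le1 v0))
         (Imp (Approx v1 v0) (Eq (v2 $ v1) (v2 $ v0)))))).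

Definition STP : form [] :=
  All ty1 (Imp (Le1 v0) (ExSt ty1 (And (Le1 v0) (Approx v1 v0)))).

(* Main.v *)
(** Suppose a binary [f] has no standard approximant.  By [HAC_int] there is a
    standard [F] such that every standard binary [g] differs from [f] at some
    element of [F(g)]; hence, with the standard [Y(g)] the sum of the list
    [F(g)], [g] differs from [f] somewhere at or below [Y(g)].  Idealisation
    turns [NUC] for [Y] into a modulus of continuity at [f]: there is a standard
    list [x] such that [Y(g) = Y(f)] for all binary [g] that agree with [f] on
    [x].  By external induction [f] agrees with a standard binary function up to
    any standard bound.  Take such functions [g1], up to the sum of [x], and
    [g2], up to the sum of [x] plus [Y(g1)].  Then [Y(g2) = Y(f) = Y(g1)], so
    [g2] agrees with [f] up to [Y(g2)], a contradiction. *)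

From Stdlib Require Import List Setoid Morphisms.
Import ListNotations.
Require Import Defs.
Set Implicit Arguments.
Local Open Scope ty_scope.
Local Open Scope tm_scope.

(** * De Bruijn variables and the calculus of substitutions *)

Definition v3 {G : ctx} {a b c d : ty} : tm (d :: c :: b :: a :: G) a :=
  Var (VS (VS (VS VZ))).
Definition v4 {G : ctx} {a b c d e : ty} : tm (e :: d :: c :: b :: a :: G) a :=
  Var (VS (VS (VS (VS VZ)))).
Definition v5 {G : ctx} {a b c d e h : ty} :
    tm (h :: e :: d :: c :: b :: a :: G) a :=
  Var (VS (VS (VS (VS (VS VZ))))).
Definition v6 {G : ctx} {a b c d e h i : ty} :
    tm (i :: h :: e :: d :: c :: b :: a :: G) a :=
  Var (VS (VS (VS (VS (VS (VS VZ)))))).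

(** The return clause quantifies over [Q] again, so the dependent match typechecks without any axiom
    on equality of contexts. *)
Lemma var_cons_ind {r : ty} {G : ctx} (Q : forall s, var (r :: G) s -> Prop) :
  Q r VZ -> (forall s (x : var G s), Q s (VS x)) -> forall s x, Q s x.
Proof.
  intros HZ HS s x.
  refine (match x as x' in var D s'
    return match D return var D s' -> Prop with
           | [] => fun _ => True
           | r' :: G' => fun y => forall Q : forall s, var (r' :: G') s -> Prop,
               Q r' VZ -> (forall s (x : var G' s), Q s (VS x)) -> Q s' y
           end x' with
  | VZ => fun Q z _ => z
  | VS y => fun Q _ f => f _ y
  end Q HZ HS).
Qed.

Lemma sub_tm_ext {G D : ctx} (f g : substitution G D) {s : ty} (t : tm G s) :
  (forall r x, f r x = g r x) -> sub_tm f t = sub_tm g t.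
Proof. intros E; induction t; simpl; congruence. Qed.

Lemma sub_tm_id {G : ctx} {s : ty} (t : tm G s) :
  sub_tm (fun _ x => Var x) t = t.
Proof. induction t; simpl; congruence. Qed.

Lemma ren_tm_sub {G D : ctx} (f : renaming G D) {s : ty} (t : tm G s) :
  ren_tm f t = sub_tm (fun _ x => Var (f _ x)) t.
Proof. induction t; simpl; congruence. Qed.

Lemma sub_tm_sub {G D E : ctx} (f : substitution G D) (g : substitution D E)
    {s : ty} (t : tm G s) :
  sub_tm g (sub_tm f t) = sub_tm (fun _ x => sub_tm g (f _ x)) t.
Proof. induction t; simpl; congruence. Qed.

Lemma sub_tm_wk {G D : ctx} {r s : ty} (f : substitution G D) (a : tm D r)
    (t : tm G s) :
  sub_tm (scons a f) (wk_tm t) = sub_tm f t.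
Proof. unfold wk_tm; rewrite ren_tm_sub, sub_tm_sub; reflexivity. Qed.

Lemma inst_tm_wk {G : ctx} {r s : ty} (a : tm G r) (t : tm G s) :
  sub_tm (scons a (fun _ x => Var x)) (wk_tm t) = t.
Proof. rewrite sub_tm_wk; apply sub_tm_id. Qed.

Lemma up_sub_wk {G D : ctx} {r s : ty} (f : substitution G D) (t : tm G s) :
  sub_tm (up_sub (r := r) f) (wk_tm t) = wk_tm (sub_tm f t).
Proof.
  unfold up_sub; rewrite sub_tm_wk; unfold wk_tm.
  rewrite ren_tm_sub, sub_tm_sub; apply sub_tm_ext; intros.
  apply ren_tm_sub.
Qed.

Lemma up_ren_wk {G D : ctx} {r s : ty} (f : renaming G D) (t : tm G s) :
  ren_tm (up_ren (r := r) f) (wk_tm t) = wk_tm (ren_tm f t).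
Proof.
  unfold wk_tm; rewrite !ren_tm_sub, !sub_tm_sub; reflexivity.
Qed.

Lemma sub_tm_shift {G : ctx} {r s : ty} (t : tm G s) :
  sub_tm (fun _ x => Var (VS (r := r) x)) t = wk_tm t.
Proof. symmetry; apply ren_tm_sub. Qed.

Lemma sub_tm_add {G D : ctx} (f : substitution G D) (a b : tm G N) :
  sub_tm f (add a b) = add (sub_tm f a) (sub_tm f b).
Proof. reflexivity. Qed.

Lemma sub_tm_succ {G D : ctx} (f : substitution G D) (a : tm G N) :
  sub_tm f (succ a) = succ (sub_tm f a).
Proof. reflexivity. Qed.

Lemma sub_tm_v0 {G D : ctx} {r : ty} (f : substitution G D) (a : tm D r) :
  sub_tm (scons a f) v0 = a.
Proof. reflexivity. Qed.

Ltac push_sub :=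
  unfold inst; cbn [sub];
  repeat first [rewrite sub_tm_add | rewrite sub_tm_succ | rewrite sub_tm_v0
               | rewrite sub_tm_wk | rewrite sub_tm_shift | rewrite sub_tm_id].

Lemma sub_tm_abs {G D E : ctx} {r s : ty}
    (e : forall s : ty, var G s -> tm D (r ~> s)) (f : substitution D E)
    (t : tm G s) :
  sub_tm f (abs_with e t) = abs_with (fun _ x => sub_tm f (e _ x)) t.
Proof. induction t; simpl; congruence. Qed.

(** [Le] hides an existential quantifier over weakened terms, so the substitution has to be commuted
    with that weakening. *)
Lemma sub_Le {G D : ctx} (f : substitution G D) (a b : tm G N) :
  sub f (Le a b) = Le (sub_tm f a) (sub_tm f b).
Proof.
  unfold Le. rewrite <- !up_sub_wk. reflexivity.
Qed.

Lemma wk_Le {G : ctx} {r : ty} (a b : tm G N) :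
  wk (r := r) (Le a b) = Le (wk_tm a) (wk_tm b).
Proof.
  change (Ex N (Eq (add (ren_tm (up_ren shift) (wk_tm a)) v0)
                   (ren_tm (up_ren shift) (wk_tm b))) = Le (wk_tm (r := r) a) (wk_tm b)).
  rewrite !up_ren_wk; reflexivity.
Qed.

(** * Derivability, and equality as a setoid *)

Definition PNUC : theory := extend P NUC.
Notation "H |- p" := (deriv PNUC H p) (at level 70, no associativity).

Lemma EPA_deriv {G : ctx} (H : list (form G)) (p : form G) : EPA p -> H |- p.
Proof. intros A; apply d_ax; left; apply EPA_ax, A. Qed.

Lemma P_deriv {G : ctx} (H : list (form G)) (p : form G) : P p -> H |- p.
Proof. intros A; apply d_ax; left; exact A. Qed.

Lemma hyp0 {G : ctx} (H : list (form G)) (p : form G) : p :: H |- p.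
Proof. apply d_hyp; left; reflexivity. Qed.

Lemma cut {G : ctx} (H : list (form G)) (p q : form G) :
  H |- p -> p :: H |- q -> H |- q.
Proof. intros A B; exact (d_impE (d_impI B) A). Qed.

(* Naming the hypotheses keeps setoid rewriting in the goal from acting on them. *)
Ltac name_hyps K := match goal with |- ?X |- _ => set (K := X) end.

Ltac hyp := apply d_hyp; solve [repeat first [left; reflexivity | right]].

(** As a Rocq relation, derivable equality can be registered for setoid rewriting, which then
    performs replacement inside derivations. *)
Definition eqt {G : ctx} (H : list (form G)) {s : ty} (a b : tm G s) : Prop :=
  H |- Eq a b.

Ltac as_eqt := match goal with |- ?K |- Eq ?a ?b => change (eqt K a b) end.

Lemma eqt_subst {G : ctx} (H : list (form G)) {s : ty} (p : form (s :: G))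
    (a b : tm G s) :
  internal p -> eqt H a b -> H |- inst a p -> H |- inst b p.
Proof.
  intros Ip E A.
  exact (d_impE (d_impE (EPA_deriv H (eq_subst_ax a b p Ip)) E) A).
Qed.

Global Instance eqt_equivalence {G : ctx} (H : list (form G)) (s : ty) :
  Equivalence (@eqt G H s).
Proof.
  assert (Sy : Symmetric (@eqt G H s)).
  { intros a b E.
    pose proof (@eqt_subst G H s (Eq v0 (wk_tm a)) a b I E) as A.
    unfold inst in A; simpl in A; rewrite !inst_tm_wk in A.
    apply A, EPA_deriv, eq_refl_ax. }
  split; [intros a; apply EPA_deriv, eq_refl_ax | exact Sy |].
  intros a b c E1 E2.
  pose proof (@eqt_subst G H s (Eq (wk_tm a) v0) b c I E2) as A.
  unfold inst in A; simpl in A; rewrite !inst_tm_wk in A.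
  apply A, E1.
Qed.

Global Instance App_eqt {G : ctx} (H : list (form G)) (s t : ty) :
  Proper (eqt H ==> eqt H ==> eqt H) (@App G s t).
Proof.
  intros f g E a b E'.
  transitivity (f $ b).
  - pose proof (@eqt_subst G H s (Eq (wk_tm f $ wk_tm a) (wk_tm f $ v0)) a b I E') as A.
    unfold inst in A; simpl sub in A; rewrite !inst_tm_wk in A.
    apply A. apply EPA_deriv, eq_refl_ax.
  - pose proof (@eqt_subst G H _ (Eq (wk_tm f $ wk_tm b) (v0 $ wk_tm b)) f g I E) as A.
    unfold inst in A; simpl sub in A; rewrite !inst_tm_wk in A.
    apply A. apply EPA_deriv, eq_refl_ax.
Qed.

Global Instance succ_eqt {G : ctx} (H : list (form G)) :
  Proper (eqt H ==> eqt H) (@succ G).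
Proof. intros a b E; unfold succ; rewrite E; reflexivity. Qed.

Global Instance add_eqt {G : ctx} (H : list (form G)) :
  Proper (eqt H ==> eqt H ==> eqt H) (@add G).
Proof. intros a b E c d E'; unfold add; rewrite E, E'; reflexivity. Qed.

Global Instance tnth_eqt {G : ctx} (H : list (form G)) (s : ty) :
  Proper (eqt H ==> eqt H ==> eqt H) (@tnth G s).
Proof. intros a b E c d E'; unfold tnth; rewrite E, E'; reflexivity. Qed.

Definition equiv {G : ctx} (H : list (form G)) (p q : form G) : Prop :=
  H |- p <-> H |- q.

Global Instance deriv_equiv {G : ctx} (H : list (form G)) :
  Proper (equiv H ==> iff) (deriv PNUC H).
Proof. intros p q E; exact E. Qed.

(** The replacement axiom covers internal formulas only; standardness is transported by its own
    axiom [st_eq_ax]. *)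
Global Instance St_eqt {G : ctx} (H : list (form G)) (s : ty) :
  Proper (eqt H ==> equiv H) (@St G s).
Proof.
  assert (L : forall a b : tm G s, eqt H a b -> H |- St a -> H |- St b).
  { intros a b E A. exact (d_impE (P_deriv H (st_eq_ax a b)) (d_andI A E)). }
  intros a b E; split; apply L; trivial; symmetry; trivial.
Qed.

Global Instance Le_eqt {G : ctx} (H : list (form G)) :
  Proper (eqt H ==> eqt H ==> equiv H) (@Le G).
Proof.
  assert (L : forall a b c d, eqt H a b -> eqt H c d -> H |- Le a c -> H |- Le b d).
  { intros a b c d E E' A.
    pose proof (@eqt_subst G H N (Le v0 (wk_tm c)) a b I E) as A1.
    pose proof (@eqt_subst G H N (Le (wk_tm b) v0) c d I E') as A2.
    unfold inst in A1, A2; rewrite !sub_Le, !inst_tm_wk in A1, A2.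
    apply A2, A1, A. }
  intros a b E c d E'; split; apply L; trivial; symmetry; trivial.
Qed.

(** * Beta conversion for bracket abstraction *)

Lemma abs_beta {G D : ctx} (H : list (form D)) {r s : ty}
    (e : forall s : ty, var G s -> tm D (r ~> s)) (f : substitution G D)
    (a : tm D r) (t : tm G s) :
  (forall s x, eqt H (e s x $ a) (f s x)) ->
  eqt H (abs_with e t $ a) (sub_tm f t).
Proof.
  intros E; induction t as [s x | s c | s t b IHb c IHc]; simpl.
  - apply E.
  - apply EPA_deriv, K_ax.
  - rewrite <- IHb, <- IHc. apply EPA_deriv, S_ax.
Qed.

(** Contracting the outer of two nested abstractions leaves the inner one under a substitution.
    Carrying a pending [f] therefore makes the rule iterable, which gives the versions for several
    arguments. *)
Lemma lam_sub_beta {G D : ctx} (H : list (form D)) {r s : ty}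
    (t : tm (r :: G) s) (f : substitution G D) (a : tm D r) :
  eqt H (sub_tm f (lam t) $ a) (sub_tm (scons a f) t).
Proof.
  unfold lam; rewrite sub_tm_abs.
  apply abs_beta; refine (var_cons_ind _ _ _); simpl; intros.
  - transitivity (Con (cK r (r ~> r)) $ a $ (Con (cK r r) $ a)).
    + apply EPA_deriv, S_ax.
    + apply EPA_deriv, K_ax.
  - apply EPA_deriv, K_ax.
Qed.

Lemma lam_beta {G : ctx} (H : list (form G)) {r s : ty}
    (t : tm (r :: G) s) (a : tm G r) :
  eqt H (lam t $ a) (sub_tm (scons a (fun _ x => Var x)) t).
Proof.
  rewrite <- lam_sub_beta, sub_tm_id; reflexivity.
Qed.

Lemma lam2_sub_beta {G D : ctx} (H : list (form D)) {r1 r2 s : ty}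
    (t : tm (r2 :: r1 :: G) s) (f : substitution G D) (a : tm D r1) (b : tm D r2) :
  eqt H (sub_tm f (lam (lam t)) $ a $ b) (sub_tm (scons b (scons a f)) t).
Proof. rewrite !lam_sub_beta; reflexivity. Qed.

Lemma lam2_beta {G : ctx} (H : list (form G)) {r1 r2 s : ty}
    (t : tm (r2 :: r1 :: G) s) (a : tm G r1) (b : tm G r2) :
  eqt H (lam (lam t) $ a $ b) (sub_tm (scons b (scons a (fun _ x => Var x))) t).
Proof. rewrite lam_beta, lam_sub_beta; reflexivity. Qed.

Lemma lam3_beta {G : ctx} (H : list (form G)) {r1 r2 r3 s : ty}
    (t : tm (r3 :: r2 :: r1 :: G) s) (a : tm G r1) (b : tm G r2) (c : tm G r3) :
  eqt H (lam (lam (lam t)) $ a $ b $ c)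
    (sub_tm (scons c (scons b (scons a (fun _ x => Var x)))) t).
Proof. rewrite lam_beta, !lam_sub_beta; reflexivity. Qed.

(** * Recursion equations and laws of addition *)

Lemma add_zero {G : ctx} (H : list (form G)) (a : tm G N) :
  eqt H (add a zero) a.
Proof. apply EPA_deriv, rec_zero_ax. Qed.

Lemma add_succ {G : ctx} (H : list (form G)) (a b : tm G N) :
  eqt H (add a (succ b)) (succ (add a b)).
Proof.
  etransitivity; [apply EPA_deriv, rec_succ_ax |].
  rewrite lam2_beta; reflexivity.
Qed.

Lemma tnth_nil {G : ctx} (H : list (form G)) (i : tm G N) :
  eqt H (tnth (tnil (s := N)) i) zero.
Proof.
  unfold tnth. transitivity (lam (G := G) (r := N) (default N) $ i).
  - apply App_eqt; [apply EPA_deriv, lrec_nil_ax | reflexivity].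
  - exact (lam_beta H (default N) i).
Qed.

(** The existential hides the bulky step term of the inner recursor and keeps its one relevant
    property: it ignores the previous value and looks up its index in the tail. *)
Lemma tnth_cons {G : ctx} (H : list (form G)) {s : ty} (a : tm G s)
    (l : tm G (Seq s)) (i : tm G N) :
  exists b : tm G (s ~> N ~> s),
    eqt H (tnth (tcons a l) i) (Con (cRec s) $ a $ b $ i) /\
    forall c j, eqt H (b $ c $ j) (tnth l j).
Proof.
  eexists; split.
  - unfold tnth. etransitivity; [apply App_eqt; [apply EPA_deriv, lrec_cons_ax | reflexivity] |].
    etransitivity; [apply lam3_beta |]. cbn [sub_tm]. reflexivity.
  - intros c j. cbv beta. etransitivity; [apply lam2_sub_beta |]. reflexivity.
Qed.

Lemma tnth_cons_zero {G : ctx} (H : list (form G)) {s : ty} (a : tm G s)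
    (l : tm G (Seq s)) :
  eqt H (tnth (tcons a l) zero) a.
Proof.
  destruct (tnth_cons H a l zero) as [b [E _]].
  rewrite E; apply EPA_deriv, rec_zero_ax.
Qed.

Lemma tnth_cons_succ {G : ctx} (H : list (form G)) {s : ty} (a : tm G s)
    (l : tm G (Seq s)) (i : tm G N) :
  eqt H (tnth (tcons a l) (succ i)) (tnth l i).
Proof.
  destruct (tnth_cons H a l (succ i)) as [b [E E']].
  rewrite E, <- E'; apply EPA_deriv, rec_succ_ax.
Qed.

Lemma nat_ind_deriv {G : ctx} (H : list (form G)) (p : form (N :: G)) :
  internal p -> H |- inst zero p ->
  (p :: map wk H) |- sub (scons (succ v0) (fun s x => Var (VS x))) p ->
  H |- All N p.
Proof.
  intros Ip A B.
  exact (d_impE (EPA_deriv H (ind_ax p Ip)) (d_andI A (d_allI _ (d_impI B)))).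
Qed.

Lemma zero_add {G : ctx} (H : list (form G)) (a : tm G N) :
  eqt H (add zero a) a.
Proof.
  assert (A : H |- All N (Eq (add zero v0) v0)); [| exact (d_allE a A)].
  apply nat_ind_deriv; [exact I | apply add_zero |].
  change (eqt (Eq (add zero v0) v0 :: map wk H) (add zero (succ v0)) (succ v0)).
  rewrite add_succ. apply succ_eqt, hyp0.
Qed.

Lemma succ_add {G : ctx} (H : list (form G)) (a b : tm G N) :
  eqt H (add (succ a) b) (succ (add a b)).
Proof.
  assert (A : H |- All N (Eq (add (succ (wk_tm a)) v0) (succ (add (wk_tm a) v0)))).
  - apply nat_ind_deriv; [exact I | |]; push_sub; as_eqt.
    + rewrite !add_zero; reflexivity.
    + rewrite !add_succ. apply succ_eqt, hyp0.
  - apply (d_allE b) in A; revert A; push_sub; trivial.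
Qed.

Lemma add_comm {G : ctx} (H : list (form G)) (a b : tm G N) :
  eqt H (add a b) (add b a).
Proof.
  assert (A : H |- All N (Eq (add (wk_tm a) v0) (add v0 (wk_tm a)))).
  - apply nat_ind_deriv; [exact I | |]; push_sub; as_eqt.
    + rewrite add_zero, zero_add; reflexivity.
    + rewrite add_succ, succ_add. apply succ_eqt, hyp0.
  - apply (d_allE b) in A; revert A; push_sub; trivial.
Qed.

Lemma add_assoc {G : ctx} (H : list (form G)) (a b c : tm G N) :
  eqt H (add (add a b) c) (add a (add b c)).
Proof.
  assert (A : H |- All N (Eq (add (add (wk_tm a) (wk_tm b)) v0)
                             (add (wk_tm a) (add (wk_tm b) v0)))).
  - apply nat_ind_deriv; [exact I | |]; push_sub; as_eqt.
    + rewrite !add_zero; reflexivity.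
    + rewrite !add_succ. apply succ_eqt, hyp0.
  - apply (d_allE c) in A; revert A; push_sub; trivial.
Qed.

(** * Order on the naturals *)

Lemma Le_intro {G : ctx} (H : list (form G)) (a b c : tm G N) :
  eqt H (add a c) b -> H |- Le a b.
Proof.
  intros E; apply d_exI with (t := c); push_sub; exact E.
Qed.

Lemma Le_add_r {G : ctx} (H : list (form G)) (a b c : tm G N) :
  H |- Le a b -> H |- Le a (add b c).
Proof.
  intros A; apply (d_exE _ A). rewrite wk_Le.
  apply Le_intro with (c := add v0 (wk_tm c)).
  rewrite <- add_assoc.
  change (wk_tm (r := N) (add b c)) with (add (wk_tm (r := N) b) (wk_tm (r := N) c)).
  apply add_eqt; [apply hyp0 | reflexivity].
Qed.

Lemma Le_add_l {G : ctx} (H : list (form G)) (a b c : tm G N) :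
  H |- Le a b -> H |- Le a (add c b).
Proof.
  intros A; rewrite (add_comm H c b). apply Le_add_r, A.
Qed.

Lemma zero_Le {G : ctx} (H : list (form G)) (a : tm G N) : H |- Le zero a.
Proof. apply Le_intro with (c := a), zero_add. Qed.

Lemma Le_refl {G : ctx} (H : list (form G)) (a : tm G N) : H |- Le a a.
Proof. apply Le_intro with (c := zero), add_zero. Qed.

(** * The sum of a list as a bound for its entries *)

Definition tsum {G : ctx} (l : tm G (Seq N)) : tm G N :=
  Con (cLRec N N) $ zero $ lam (lam (add v1 v0)) $ l.

Global Instance tsum_eqt {G : ctx} (H : list (form G)) :
  Proper (eqt H ==> eqt H) (@tsum G).
Proof. intros a b E; unfold tsum; rewrite E; reflexivity. Qed.

Lemma tsum_cons {G : ctx} (H : list (form G)) (a : tm G N) (l : tm G (Seq N)) :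
  eqt H (tsum (tcons a l)) (add (tsum l) a).
Proof.
  etransitivity; [apply EPA_deriv, lrec_cons_ax |].
  rewrite lam2_beta; reflexivity.
Qed.

Lemma seq_cases {G : ctx} (H : list (form G)) {s : ty} (l : tm G (Seq s)) (q : form G) :
  Eq l tnil :: H |- q ->
  Eq (wk_tm (wk_tm l)) (tcons v1 v0) ::
    wk (Ex (Seq s) (Eq (wk_tm (wk_tm l)) (tcons v1 v0))) ::
    map wk (map wk (Ex s (Ex (Seq s) (Eq (wk_tm (wk_tm l)) (tcons v1 v0))) :: H))
    |- wk (wk q) ->
  H |- q.
Proof.
  intros A B.
  apply (d_orE (EPA_deriv H (seq_ax l)) A).
  apply (d_exE _ (hyp0 _ _)).
  apply (d_exE _ (hyp0 _ _)).
  exact B.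
Qed.

(** Induction on the index with the list still quantified, since the successor case passes to the
    tail. Lookup in the empty list gives the default 0, so the bound also holds past the end. *)
Lemma tnth_Le_tsum_all {G : ctx} (H : list (form G)) :
  H |- All N (All (Seq N) (Le (tnth v0 v1) (tsum v0))).
Proof.
  apply nat_ind_deriv; [exact I | |]; apply d_allI; name_hyps K.
  - change (K |- Le (tnth v0 zero) (tsum v0)).
    apply seq_cases with (l := v0); name_hyps K'.
    + assert (E : eqt K' v0 tnil) by apply hyp0.
      rewrite E, tnth_nil; apply zero_Le.
    + change (K' |- Le (tnth v2 zero) (tsum v2)).
      assert (E : eqt K' v2 (tcons v1 v0)) by apply hyp0.
      rewrite E, tnth_cons_zero, tsum_cons. apply Le_add_l, Le_refl.
  - change (K |- Le (tnth v0 (succ v1)) (tsum v0)).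
    apply seq_cases with (l := v0); name_hyps K'.
    + assert (E : eqt K' v0 tnil) by apply hyp0.
      rewrite E, tnth_nil; apply zero_Le.
    + change (K' |- Le (tnth v2 (succ v3)) (tsum v2)).
      assert (E : eqt K' v2 (tcons v1 v0)) by apply hyp0.
      rewrite E, tnth_cons_succ, tsum_cons. apply Le_add_r.
      assert (A : K' |- All (Seq N) (Le (tnth v0 v4) (tsum v0))).
      { hyp. }
      exact (d_allE v0 A).
Qed.

Lemma tnth_Le_tsum {G : ctx} (H : list (form G)) (l : tm G (Seq N)) (i : tm G N) :
  H |- Le (tnth l i) (tsum l).
Proof.
  assert (A : H |- All (Seq N) (Le (tnth v0 (wk_tm i)) (tsum v0)))
    by exact (d_allE i (tnth_Le_tsum_all H)).
  apply (d_allE l) in A; unfold inst in A; rewrite sub_Le in A.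
  change (H |- Le (tnth l (sub_tm (scons l (fun _ x => Var x)) (wk_tm i))) (tsum l)) in A.
  rewrite inst_tm_wk in A; exact A.
Qed.

Lemma Mem_Le_tsum {G : ctx} (H : list (form G)) (l : tm G (Seq N)) (a : tm G N) :
  H |- Mem a l -> H |- Le a (tsum l).
Proof.
  intros A; apply (d_exE _ A). rewrite wk_Le; name_hyps K.
  assert (E : eqt K (tnth (wk_tm l) v0) (wk_tm a)) by exact (d_andE2 (hyp0 _ _)).
  rewrite <- E. apply tnth_Le_tsum.
Qed.

(** * Case distinction and standardness of terms *)

Lemma nat_cases {G : ctx} (H : list (form G)) (a : tm G N) (q : form G) :
  Eq a zero :: H |- q ->
  Eq (wk_tm a) (succ v0) :: map wk (Ex N (Eq (wk_tm a) (succ v0)) :: H) |- wk q ->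
  H |- q.
Proof.
  intros A B.
  assert (C : H |- All N (Or (Eq v0 zero) (Ex N (Eq v1 (succ v0))))).
  { apply nat_ind_deriv; [repeat split | |].
    - apply d_orI1, EPA_deriv, eq_refl_ax.
    - apply d_orI2, d_exI with (t := v0), EPA_deriv, eq_refl_ax. }
  apply (d_orE (d_allE a C) A).
  exact (d_exE _ (hyp0 _ _) B).
Qed.

Lemma succ_inj {G : ctx} (H : list (form G)) (a b : tm G N) :
  eqt H (succ a) (succ b) -> eqt H a b.
Proof. apply d_impE, EPA_deriv, succ_inj_ax. Qed.

Lemma succ_ne_zero {G : ctx} (H : list (form G)) (a : tm G N) (q : form G) :
  eqt H (succ a) zero -> H |- q.
Proof.
  intros E; exact (d_botE _ (d_impE (EPA_deriv H (succ_ne_zero_ax a)) E)).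
Qed.

Lemma add_eq_zero {G : ctx} (H : list (form G)) (a b : tm G N) :
  eqt H (add a b) zero -> eqt H a zero.
Proof.
  (* The equation becomes a hypothesis of the sequent so that it survives into the extended context
     of the case split. *)
  intros A; refine (d_impE (p := Eq (add a b) zero) _ A).
  apply d_impI, nat_cases with (a := a); [apply hyp0 |]; name_hyps K.
  assert (E : eqt K (wk_tm a) (succ v0)) by apply hyp0.
  assert (F : eqt K (add (wk_tm a) (wk_tm b)) zero) by hyp.
  rewrite E, succ_add in F. exact (succ_ne_zero _ F).
Qed.

Lemma St_closed {G : ctx} (H : list (form G)) {s : ty} (t : tm [] s) :
  H |- St (ren_tm (@of_nil G) t).
Proof. apply P_deriv, st_closed_ax. Qed.

Lemma St_App {G : ctx} (H : list (form G)) {s t : ty} (f : tm G (s ~> t)) (a : tm G s) :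
  H |- St f -> H |- St a -> H |- St (f $ a).
Proof. intros A B; exact (d_impE (P_deriv H (st_app_ax f a)) (d_andI A B)). Qed.

Lemma St_Con {G : ctx} (H : list (form G)) {s : ty} (c : con s) :
  H |- St (Con c).
Proof. exact (St_closed H (Con c)). Qed.

(** Such a number is 0 or 1, a closed term. Hence even a nonstandard binary function has standard
    values, from which standard prefixes can be built. *)
Lemma St_Le_one {G : ctx} (H : list (form G)) (a : tm G N) :
  H |- Le a one -> H |- St a.
Proof.
  intros A; apply (d_exE _ A).
  change (wk (St a)) with (St (wk_tm (r := N) a)).
  apply nat_cases with (a := wk_tm a); name_hyps K.
  - assert (E : eqt K (wk_tm a) zero) by apply hyp0.
    rewrite E; apply St_Con.
  - change (K |- St (wk_tm (wk_tm a))).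
    assert (E : eqt K (wk_tm (wk_tm a)) (succ v0)) by apply hyp0.
    assert (F : eqt K (add (wk_tm (wk_tm a)) v1) one) by hyp.
    rewrite E, succ_add in F. apply succ_inj, add_eq_zero in F.
    rewrite E, F. apply St_App; apply St_Con.
Qed.

Lemma Le_succ_inv {G : ctx} (H : list (form G)) (a b : tm G N) :
  H |- Le (succ a) (succ b) -> H |- Le a b.
Proof.
  intros A; apply (d_exE _ A). rewrite wk_Le; name_hyps K.
  assert (E : eqt K (add (succ (wk_tm a)) v0) (succ (wk_tm b))) by apply hyp0.
  rewrite succ_add in E.
  apply Le_intro with (c := v0), succ_inj, E.
Qed.

Lemma succ_Le_zero {G : ctx} (H : list (form G)) (a : tm G N) (q : form G) :
  H |- Le (succ a) zero -> H |- q.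
Proof.
  intros A; apply (d_exE _ A); name_hyps K.
  assert (E : eqt K (add (succ (wk_tm a)) v0) zero) by apply hyp0.
  rewrite succ_add in E. exact (succ_ne_zero _ E).
Qed.

Lemma Le1_App {G : ctx} (H : list (form G)) (f : tm G ty1) (a : tm G N) :
  H |- Le1 f -> H |- Le (f $ a) one.
Proof.
  intros A; apply (d_allE a) in A; unfold inst in A; rewrite sub_Le in A.
  cbn [sub_tm] in A; rewrite inst_tm_wk in A; exact A.
Qed.

Lemma St_add {G : ctx} (H : list (form G)) (a b : tm G N) :
  H |- St a -> H |- St b -> H |- St (add a b).
Proof.
  intros A B; apply St_App; [apply St_App; [apply St_App |] |]; trivial.
  - apply St_Con.
  - exact (St_closed H (lam (lam (succ v1)))).
Qed.

Lemma St_tsum {G : ctx} (H : list (form G)) (l : tm G (Seq N)) :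
  H |- St l -> H |- St (tsum l).
Proof.
  intros A; apply St_App; trivial.
  exact (St_closed H (Con (cLRec N N) $ zero $ lam (lam (add v1 v0)))).
Qed.

(** * Standard prefixes of binary functions *)

Definition Agree {G : ctx} (f g : tm G ty1) (k : tm G N) : form G :=
  All N (Imp (Le v0 (wk_tm k)) (Eq (wk_tm f $ v0) (wk_tm g $ v0))).

Lemma Agree_App {G : ctx} (H : list (form G)) (f g : tm G ty1) (k a : tm G N) :
  H |- Agree f g k -> H |- Le a k -> eqt H (f $ a) (g $ a).
Proof.
  intros A; apply (d_allE a) in A; unfold inst in A; cbn [sub] in A.
  rewrite sub_Le in A; cbn [sub_tm] in A; rewrite !inst_tm_wk in A.
  exact (d_impE A).
Qed.

(* [fcons a g] is the function with values a, g(0), g(1), ... *)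
Definition fcons {G : ctx} : tm G (N ~> ty1 ~> ty1) :=
  lam (lam (lam (Con (cRec N) $ v2 $ lam (lam (v3 $ v0)) $ v0))).

Lemma fcons_zero {G : ctx} (H : list (form G)) (a : tm G N) (g : tm G ty1) :
  eqt H (fcons $ a $ g $ zero) a.
Proof.
  etransitivity; [apply lam3_beta |]; cbn [sub_tm].
  apply EPA_deriv, rec_zero_ax.
Qed.

Lemma fcons_succ {G : ctx} (H : list (form G)) (a : tm G N) (g : tm G ty1) (n : tm G N) :
  eqt H (fcons $ a $ g $ succ n) (g $ n).
Proof.
  etransitivity; [apply lam3_beta |]; cbn [sub_tm].
  etransitivity; [apply EPA_deriv, rec_succ_ax |].
  etransitivity; [apply lam2_sub_beta |]; reflexivity.
Qed.

Lemma fcons_Le1_all {G : ctx} (H : list (form G)) :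
  H |- All ty1 (All ty1 (Imp (Le1 v1) (Imp (Le1 v0) (Le1 (fcons $ (v1 $ zero) $ v0))))).
Proof.
  apply d_allI, d_allI, d_impI, d_impI, d_allI; name_hyps K.
  change (K |- Le (fcons $ (v2 $ zero) $ v1 $ v0) one).
  apply nat_cases with (a := v0); name_hyps K'.
  - assert (E : eqt K' v0 zero) by apply hyp0.
    assert (A : K' |- Le1 v2) by hyp.
    rewrite E, fcons_zero. apply Le1_App, A.
  - change (K' |- Le (fcons $ (v3 $ zero) $ v2 $ v1) one).
    assert (E : eqt K' v1 (succ v0)) by apply hyp0.
    assert (A : K' |- Le1 v2) by hyp.
    rewrite E, fcons_succ. apply Le1_App, A.
Qed.

(** Here [f] may be nonstandard. The formula contains [St], so an induction on [k] has to be the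
    external one. *)
Definition StPrefix {G : ctx} (f : tm G ty1) (k : tm G N) : form G :=
  ExSt ty1 (And (Le1 v0) (Agree (wk_tm f) v0 (wk_tm k))).

Lemma StPrefix_zero {G : ctx} (H : list (form G)) :
  H |- All ty1 (Imp (Le1 v0) (StPrefix v0 zero)).
Proof.
  apply d_allI, d_impI; name_hyps K.
  assert (Hf : K |- Le1 v0) by apply hyp0.
  (* The witness takes the value f(0) at 0 and the value 0 everywhere else. *)
  apply d_exI with (t := fcons $ (v0 $ zero) $ default ty1).
  apply d_andI; [| apply d_andI].
  - change (K |- St (fcons $ (v0 $ zero) $ default ty1)).
    apply St_App; [apply St_App |].
    + exact (St_closed K fcons).
    + apply St_Le_one, Le1_App, Hf.
    + exact (St_closed K (default ty1)).
  - refine (d_impE (d_impE (d_allE (default ty1) (d_allE v0 (fcons_Le1_all K))) Hf) _).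
    apply d_allI. name_hyps K'. change (K' |- Le (default ty1 $ v0) one).
    assert (E : eqt K' (default ty1 $ v0) zero) by apply EPA_deriv, K_ax.
    rewrite E; apply zero_Le.
  - apply d_allI, d_impI. name_hyps K'.
    change (K' |- Eq (v1 $ v0) (fcons $ (v1 $ zero) $ default ty1 $ v0)).
    apply nat_cases with (a := v0); name_hyps K''.
    + assert (E : eqt K'' v0 zero) by apply hyp0.
      as_eqt; rewrite E, fcons_zero; reflexivity.
    + assert (E : eqt K'' v1 (succ v0)) by apply hyp0.
      assert (L : K'' |- Le v1 zero) by hyp.
      rewrite E in L. exact (succ_Le_zero _ L).
Qed.

(** External induction on the bound, with [f] quantified inside: the induction hypothesis is applied
    to the tail of [f], and f(0) is put in front of the resulting prefix. *)
Lemma StPrefix_all {G : ctx} (H : list (form G)) :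
  H |- AllSt N (All ty1 (Imp (Le1 v0) (StPrefix v0 v1))).
Proof.
  refine (d_impE (P_deriv H (st_ind_ax _)) (d_andI _ _)); [apply StPrefix_zero |].
  apply d_allI, d_impI, d_impI, d_allI, d_impI; name_hyps K.
  change (K |- StPrefix v0 (succ v1)).
  set (f' := fun G (f : tm (N :: G) ty1) => lam (f $ succ v0)).
  assert (Hf : K |- Le1 v0) by apply hyp0.
  assert (Hf' : K |- Le1 (f' _ v1)).
  { apply d_allI; name_hyps K'.
    change (K' |- Le (lam (v2 $ succ v0) $ v0) one).
    assert (A : K' |- Le1 v1) by hyp.
    rewrite lam_beta. exact (Le1_App (succ v0) A). }
  assert (A : K |- StPrefix (f' _ v1) v1).
  { refine (d_impE _ Hf').
    assert (B : K |- All ty1 (Imp (Le1 v0) (StPrefix v0 v2))) by hyp.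
    exact (d_allE (f' _ v1) B). }
  apply (d_exE _ A); clear A Hf Hf'; name_hyps K'.
  assert (Hf : K' |- Le1 v1) by hyp.
  assert (A : K' |- And (St v0) (And (Le1 v0) (Agree (f' _ v2) v0 v2))) by apply hyp0.
  pose proof (d_andE1 A) as Sg; pose proof (d_andE1 (d_andE2 A)) as Hg.
  apply d_exI with (t := fcons $ (v1 $ zero) $ v0).
  apply d_andI; [| apply d_andI].
  - change (K' |- St (fcons $ (v1 $ zero) $ v0)).
    apply St_App; [apply St_App | exact Sg].
    + exact (St_closed K' fcons).
    + apply St_Le_one, Le1_App, Hf.
  - exact (d_impE (d_impE (d_allE v0 (d_allE v1 (fcons_Le1_all K'))) Hf) Hg).
  - clear A Sg Hg Hf.
    apply d_allI, d_impI; name_hyps K2.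
    change (K2 |- Eq (v2 $ v0) (fcons $ (v2 $ zero) $ v1 $ v0)).
    apply nat_cases with (a := v0); name_hyps K3.
    + assert (E : eqt K3 v0 zero) by apply hyp0.
      as_eqt; rewrite E, fcons_zero; reflexivity.
    + change (K3 |- Eq (v3 $ v1) (fcons $ (v3 $ zero) $ v2 $ v1)).
      assert (E : eqt K3 v1 (succ v0)) by apply hyp0.
      assert (L : K3 |- Le v1 (succ v4)) by hyp.
      assert (A : K3 |- And (St v2) (And (Le1 v2) (Agree (f' _ v4) v2 v4))) by hyp.
      (* The argument is m+1 with m+1 <= k+1, so m <= k and the prefix of the tail takes the value
         f(m+1) at m. *)
      rewrite E in L; apply Le_succ_inv in L.
      pose proof (Agree_App (d_andE2 (d_andE2 A)) L) as B.
      unfold f' in B; rewrite lam_beta in B.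
      as_eqt; rewrite E, fcons_succ, <- B; reflexivity.
Qed.

(** * The contradiction from a binary function without standard approximant *)

Lemma NUC_deriv {G : ctx} (H : list (form G)) :
  H |- AllSt ty2 (All ty1 (All ty1
    (Imp (And (Le1 v1) (Le1 v0))
         (Imp (Approx v1 v0) (Eq (v2 $ v1) (v2 $ v0)))))).
Proof. apply d_ax; right; reflexivity. Qed.

(* [sumF F] is the functional Y of the proof idea. *)
Definition sumF {G : ctx} : tm G ((ty1 ~> Seq N) ~> ty2) :=
  lam (lam (tsum (v1 $ v0))).

Lemma sumF_App {G : ctx} (H : list (form G)) (F : tm G (ty1 ~> Seq N)) (g : tm G ty1) :
  eqt H (sumF $ F $ g) (tsum (F $ g)).
Proof. etransitivity; [apply lam2_beta |]; reflexivity. Qed.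

(* Variables, innermost first: n, g, f. *)
Definition Differ {G : ctx} : form (N :: ty1 :: ty1 :: G) :=
  Imp (Le1 v1) (Not (Eq (v2 $ v0) (v1 $ v0))).

(** With binarity as a premise inside [Differ], the statement ranges over all standard [g], which is
    the shape that [HAC_int_ax] takes. *)
Lemma no_approx_Differ {G : ctx} (H : list (form (ty1 :: G))) :
  Not (ExSt ty1 (And (Le1 v0) (Approx v1 v0))) :: H |- AllSt ty1 (ExSt N Differ).
Proof.
  apply d_allI, d_impI, d_raa; name_hyps K.
  assert (A : K |- Not (ExSt ty1 (And (Le1 v0) (Approx v2 v0)))) by hyp.
  apply (d_impE A), d_exI with (t := v0).
  apply d_andI; [hyp | apply d_andI].
  - apply d_raa.
    apply (d_impE (p := ExSt N Differ)); [hyp |].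
    (* For a [g] that is not binary, [Differ] holds vacuously, and 0 is a standard witness. *)
    apply d_exI with (t := zero), d_andI; [apply St_Con |].
    apply d_impI, d_botE, (d_impE (p := Le1 v0)); hyp.
  - apply d_allI, d_impI, d_raa; name_hyps K'.
    assert (B : K' |- Not (ExSt N (Imp (Le1 v2) (Not (Eq (v3 $ v0) (v2 $ v0)))))) by hyp.
    apply (d_impE B), d_exI with (t := v0), d_andI; [hyp |].
    apply d_impI; hyp.
Qed.

(* Variables, innermost first: z, g, F, f.  Only the second conjunct depends on
   z, so idealising over z yields one g that is close to f with Y(g) <> Y(f). *)
Definition Refutes {G : ctx} : form (N :: ty1 :: (ty1 ~> Seq N) :: ty1 :: G) :=
  And (Le1 v1) (And (Eq (v3 $ v0) (v1 $ v0))
                    (Not (Eq (sumF $ v2 $ v3) (sumF $ v2 $ v1)))).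

(** Such a [g] would be binary with f ≈ g, so [NUC] at the standard functional Y = [sumF $ F] would
    give Y(f) = Y(g). *)
Lemma NUC_no_Refutes {G : ctx} (H : list (form ((ty1 ~> Seq N) :: ty1 :: G))) :
  St v0 :: Le1 v1 :: H |- Not (Ex ty1 (AllSt N Refutes)).
Proof.
  apply d_impI, (d_exE _ (hyp0 _ _)); name_hyps K.
  assert (Y : K |- St (sumF $ v1)).
  { apply St_App; [exact (St_closed K sumF) | hyp]. }
  assert (A : K |- AllSt N (And (Le1 v1) (And (Eq (v3 $ v0) (v1 $ v0))
    (Not (Eq (sumF $ v2 $ v3) (sumF $ v2 $ v1)))))) by hyp.
  (* The conjuncts free of z are read off at one standard number, here 0. *)
  pose proof (d_impE (d_allE zero A) (St_Con K cZero)) as B.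
  apply (d_impE (d_andE2 (d_andE2 B))).
  refine (d_impE (d_impE (d_allE v0 (d_allE v2
    (d_impE (d_allE (sumF $ v1) (NUC_deriv K)) Y))) _) _).
  - apply d_andI; [hyp | exact (d_andE1 B)].
  - clear A B Y; apply d_allI, d_impI; name_hyps K'.
    assert (A : K' |- AllSt N (And (Le1 v2) (And (Eq (v4 $ v0) (v2 $ v0))
      (Not (Eq (sumF $ v3 $ v4) (sumF $ v3 $ v2)))))) by hyp.
    refine (d_andE1 (d_andE2 (d_impE (d_allE v0 A) _))); hyp.
Qed.

(* The free variables are x, F, f.  The slack c in the bound sum(x) + c serves
   g1 with c = 0 and g2 with c = Y(g1). *)
Lemma modulus {G : ctx} (H : list (form (Seq N :: (ty1 ~> Seq N) :: ty1 :: G))) :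
  Not (Ex ty1 (AllIn v1 (wk_under2 Refutes))) :: H |-
    All N (All ty1 (Imp (Le1 v0) (Imp (Agree v4 v0 (add (tsum v2) v1))
      (Eq (sumF $ v3 $ v4) (sumF $ v3 $ v0))))).
Proof.
  apply d_allI, d_allI, d_impI, d_impI, d_raa; name_hyps K.
  assert (A : K |- Not (Ex ty1 (AllIn v3 (And (Le1 v1)
    (And (Eq (v6 $ v0) (v1 $ v0))
         (Not (Eq (sumF $ v5 $ v6) (sumF $ v5 $ v1)))))))) by hyp.
  (* If Y(f) and Y(g) differed, this [g] would be the excluded witness: every entry of x is at most
     sum(x), hence within the range of agreement. *)
  apply (d_impE A), d_exI with (t := v0), d_allI, d_impI; name_hyps K'.
  apply d_andI; [hyp | apply d_andI; [| hyp]].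
  assert (B : K' |- Agree v5 v1 (add (tsum v3) v2)) by hyp.
  apply (Agree_App B), Le_add_r, Mem_Le_tsum; hyp.
Qed.

Lemma Differ_inconsistent {G : ctx} (H : list (form ((ty1 ~> Seq N) :: ty1 :: G))) :
  AllSt ty1 (ExIn (v1 $ v0) (wk_under2 Differ)) :: St v0 :: Le1 v1 :: H |- Bot.
Proof.
  name_hyps K.
  refine (d_impE (cut (p := Le1 v1) _ (cut (p := St v0) _ (NUC_no_Refutes _))) _);
    [hyp | hyp |].
  (* By idealisation it suffices to find, for each standard list x, a [g] that satisfies [Refutes]
     at the entries of x. A list x admitting none yields the modulus. *)
  refine (d_impE (P_deriv K (ideal_ax _ _)) _); [repeat split |].
  apply d_allI, d_impI, d_raa.
  apply (cut (modulus _)); name_hyps K1.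
  assert (P1 : K1 |- StPrefix v2 (add (tsum v0) zero)).
  { refine (d_impE (d_allE v2 (d_impE (d_allE (add (tsum v0) zero)
      (StPrefix_all K1)) _)) _); [| hyp].
    change (K1 |- St (add (tsum v0) zero)); rewrite add_zero. apply St_tsum; hyp. }
  apply (d_exE _ P1); clear P1; name_hyps K2.
  (* The bound for g2 is standard because F and g1 are, so g1 has to be obtained first. *)
  assert (P2 : K2 |- StPrefix v3 (add (tsum v1) (sumF $ v2 $ v0))).
  { refine (d_impE (d_allE v3 (d_impE (d_allE (add (tsum v1) (sumF $ v2 $ v0))
      (StPrefix_all K2)) _)) _); [| hyp].
    apply St_add; [apply St_tsum; hyp |].
    apply St_App; [apply St_App; [exact (St_closed K2 sumF) | hyp] |].
    refine (d_andE1 (q := And (Le1 v0) (Agree v3 v0 (add (tsum v1) zero))) _); hyp. }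
  apply (d_exE _ P2); clear P2; name_hyps K3.
  (* v0, ..., v4 are g2, g1, x, F, f. *)
  assert (M : K3 |- All N (All ty1 (Imp (Le1 v0) (Imp (Agree v6 v0 (add (tsum v4) v1))
      (Eq (sumF $ v5 $ v6) (sumF $ v5 $ v0)))))) by hyp.
  assert (A1 : K3 |- And (St v1) (And (Le1 v1) (Agree v4 v1 (add (tsum v2) zero)))) by hyp.
  assert (A2 : K3 |- And (St v0) (And (Le1 v0)
                       (Agree v4 v0 (add (tsum v2) (sumF $ v3 $ v1))))) by hyp.
  assert (E1 : eqt K3 (sumF $ v3 $ v4) (sumF $ v3 $ v1))
    by exact (d_impE (d_impE (d_allE v1 (d_allE zero M)) (d_andE1 (d_andE2 A1)))
                (d_andE2 (d_andE2 A1))).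
  assert (E2 : eqt K3 (sumF $ v3 $ v4) (sumF $ v3 $ v0))
    by exact (d_impE (d_impE (d_allE v0 (d_allE (sumF $ v3 $ v1) M))
                        (d_andE1 (d_andE2 A2)))
                (d_andE2 (d_andE2 A2))).
  assert (E : K3 |- Eq (sumF $ v3 $ v0) (sumF $ v3 $ v1))
    by (as_eqt; rewrite <- E1, <- E2; reflexivity).
  assert (D : K3 |- AllSt ty1 (ExIn (v4 $ v0) (Imp (Le1 v1) (Not (Eq (v6 $ v0) (v1 $ v0))))))
    by hyp.
  (* Joined into one hypothesis, the equation Y(g2) = Y(g1) and the instance at g2 both pass into
     the context of the next existential elimination. *)
  assert (X : K3 |- And (Eq (sumF $ v3 $ v0) (sumF $ v3 $ v1))
    (ExIn (v3 $ v0) (Imp (Le1 v1) (Not (Eq (v5 $ v0) (v1 $ v0)))))).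
  { apply d_andI; [exact E | exact (d_impE (d_allE v0 D) (d_andE1 A2))]. }
  apply (cut X); clear M A1 A2 E1 E2 E D X.
  apply (d_exE _ (d_andE2 (hyp0 _ _))); name_hyps K4.
  assert (A : K4 |- And (Mem v0 (v4 $ v1)) (Imp (Le1 v1) (Not (Eq (v5 $ v0) (v1 $ v0)))))
    by apply hyp0.
  assert (E : eqt K4 (sumF $ v4 $ v1) (sumF $ v4 $ v2)).
  { refine (d_andE1 (q := ExIn (v4 $ v1) (Imp (Le1 v2) (Not (Eq (v6 $ v0) (v2 $ v0))))) _); hyp. }
  assert (A2 : K4 |- And (St v1) (And (Le1 v1)
                       (Agree v5 v1 (add (tsum v3) (sumF $ v4 $ v2))))) by hyp.
  apply (d_impE (d_impE (d_andE2 A) (d_andE1 (d_andE2 A2)))).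
  (* The chosen n in F(g2) satisfies n <= sum(F(g2)) = Y(g2) = Y(g1), within the range where g2
     agrees with f. *)
  apply (Agree_App (d_andE2 (d_andE2 A2))), Le_add_l.
  rewrite <- E, sumF_App. apply Mem_Le_tsum, (d_andE1 A).
Qed.

Theorem theorem3p2 : provable (extend P NUC) STP.
Proof.
  change ([] |- STP); apply d_allI, d_impI, d_raa; name_hyps K.
  assert (A : K |- ExSt (ty1 ~> Seq N) (AllSt ty1 (ExIn (v1 $ v0) (wk_under2 Differ)))).
  { refine (d_impE (P_deriv K (HAC_int_ax _ _)) _); [repeat split |].
    apply no_approx_Differ. }
  apply (d_exE _ A); name_hyps K'.
  assert (B : K' |- And (St v0) (AllSt ty1 (ExIn (v1 $ v0) (wk_under2 Differ))))
    by apply hyp0.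
  (* The three facts become leading hypotheses, in the order that [Differ_inconsistent] takes
     them. *)
  refine (d_impE (d_impE (d_impE _ _) (d_andE1 B)) (d_andE2 B)).
  - do 3 apply d_impI. apply Differ_inconsistent.
  - hyp.
Qed.
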